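(* Let $\mathbb{F}_q$ be a finite field and let $x>0$ be real. (1) There is one, and only one, $x$-superior highly composite polynomial in $\mathbb{F}_q[t]$, namely $$\hat{h}(x)=\prod_{k\ge 1}\prod_{p\in\mathcal{I}_k}p^{a_k},\qquad a_k=a_k(x)=\left\lfloor \frac{1}{q^{k/x}-1}\right\rfloor .$$ Moreover, $\hat{h}(x)$ is the unique highly composite polynomial of its degree. (2) If $x'<x''$ are two consecutive elements of the set $S=\left\{\frac{s\log q}{\log(1+1/r)} : s,r\ge 1 \text{ integers}\right\}$, then $\hat{h}(x)=\hat{h}(x')$ for all $x'\le x<x''$. Consequently, the map $x\mapsto \hat{h}(x)$ is a one-to-one correspondence between $S$ and the set of superior highly composite polynomials.
   Context: $\mathcal{M}$ is the set of monic polynomials in $\mathbb{F}_q[t]$, $\mathcal{M}_n$ those of degree $n$, $\mathcal{I}$ the set of monic irreducible polynomials and $\mathcal{I}_k$ those of degree $k$. For $f\in\mathcal{M}$, $\tau(f)$ is the number of monic divisors of $f$; if $f=\prod_{p\in\mathcal{I}}p^{a_p}$ then $\tau(f)=\prod_p(1+a_p)$. A polynomial $f\in\mathcal{M}$ is highly composite of degree $n=\deg f$ if $\tau(f)=\max\{\tau(g): g\in\mathcal{M},\ \deg g\le n\}$. For $x>0$, $h\in\mathcal{M}$ is $x$-superior highly composite ($x$-SHC) if for all $f\in\mathcal{M}$: $\tau(h)/q^{\deg h/x}\ge \tau(f)/q^{\deg f/x}$ when $\deg h\ge \deg f$, and $\tau(h)/q^{\deg h/x}> \tau(f)/q^{\deg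 f/x}$ when $\deg h<\deg f$. A polynomial is superior highly composite if it is $x$-SHC for some $x>0$.
   Formalization: The one-to-one correspondence is between S and the superior highly composite polynomials other than the constant 1: for 0<x<log q/log 2 one has ĥ(x)=1, so 1 is superior highly composite, but ĥ(x)≠1 for every x in S. *)

(* Defs.v *)
From HB Require Import structures.
From mathcomp Require Import all_boot all_order all_algebra.
From mathcomp Require Import qpoly.
From mathcomp Require Import all_classical all_reals all_analysis.

Set Implicit Arguments.
Unset Strict Implicit.
Unset Printing Implicit Defensive.

Import Order.TTheory GRing.Theory Num.Theory.

Local Open Scope classical_set_scope.
Local Open Scope ring_scope.

(* Only used on nonzero polynomials; [pdeg 0 = 0] is a junk value. *)
Definition pdeg (F : finFieldType) (f : {poly F}) : nat := (size f).-1.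

(* For [f != 0] every divisor of [f] has size at most [size f], hence belongs
   to the finite type [{poly_(size f) F}]. *)
Definition tau (F : finFieldType) (f : {poly F}) : nat :=
  #|[pred d : {poly_(size f) F} | (val d \is monic) && (val d %| f)]|.

Definition monic_irreducible (F : finFieldType) (k : nat) : set {poly F} :=
  [set p | p \is monic /\ irreducible_poly p /\ pdeg p = k].
Arguments monic_irreducible : clear implicits.

(* [tau f] itself belongs to the set whose maximum is taken, so being that
   maximum is being an upper bound of it. *)
Definition highly_composite (F : finFieldType) (f : {poly F}) : Prop :=
  f \is monic /\
  forall g : {poly F}, g \is monic -> (pdeg g <= pdeg f)%N ->
    (tau g <= tau f)%N.

Definition weighted_tau (F : finFieldType) (R : realType) (x : R)
    (f : {poly F}) : R :=
  (tau f)%:R / #|F|%:R `^ ((pdeg f)%:R / x).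

Definition x_SHC (F : finFieldType) (R : realType) (x : R) (h : {poly F}) :
    Prop :=
  h \is monic /\
  forall f : {poly F}, f \is monic ->
    ((pdeg f <= pdeg h)%N -> weighted_tau x f <= weighted_tau x h) /\
    ((pdeg h < pdeg f)%N -> weighted_tau x f < weighted_tau x h).

Definition SHC (F : finFieldType) (R : realType) : set {poly F} :=
  [set h | exists2 x : R, 0 < x & x_SHC x h].
Arguments SHC : clear implicits.

(* For [0 < x] and [1 <= k] the argument is positive, so [Num.truncn] is its
   floor. *)
Definition shc_exp (F : finFieldType) (R : realType) (x : R) (k : nat) : nat :=
  Num.truncn (1 / (#|F|%:R `^ (k%:R / x) - 1)).
Arguments shc_exp F {R} x k.

(* The big operators are finitely supported products: the inner index set is
   finite (lemma [finite_monic_irreducible]) and, for [0 < x], all but finitely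
   many exponents vanish (lemma [finite_shc_exp]). *)
Definition hhat (F : finFieldType) (R : realType) (x : R) : {poly F} :=
  \big[*%R/1]_(k \in [set k : nat | (1 <= k)%N])
    \big[*%R/1]_(p \in monic_irreducible F k) (p ^+ shc_exp F x k).
Arguments hhat F {R} x.

Definition shc_set (F : finFieldType) (R : realType) : set R :=
  [set y | exists s r : nat, (1 <= s)%N /\ (1 <= r)%N /\
    y = s%:R * ln #|F|%:R / ln (1 + 1 / r%:R)].
Arguments shc_set : clear implicits.

Definition consecutive (R : realType) (A : set R) (a b : R) : Prop :=
  [/\ A a, A b, a < b & forall y, A y -> ~~ ((a < y) && (y < b))].

Lemma finite_monic_irreducible (F : finFieldType) (k : nat) :
  finite_set (monic_irreducible F k).
Proof.
apply: (@sub_finite_set _ _ ((fun d : {poly_k.+1 F} => val d) @` setT)).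
  move=> p [_ [_ pk]].
  have sp : (size p <= k.+1)%N by rewrite -pk leqSpred.
  by exists (NPoly sp : {poly_k.+1 F}).
by apply: finite_image; apply: finite_finset.
Qed.

Lemma finite_shc_exp (F : finFieldType) (R : realType) (x : R) : 0 < x ->
  finite_set [set k | (1 <= k)%N /\ shc_exp F x k <> 0%N].
Proof.
move=> x0.
have q1 : 1 < #|F|%:R :> R by rewrite ltr1n card_finNzRing_gt1.
have lq : 0 < ln #|F|%:R :> R by rewrite ln_gt0.
pose N := Num.bound (x * ln 2 / ln #|F|%:R).
apply: (@sub_finite_set _ _ `I_N); last exact: finite_II.
move=> k [k1 /eqP ak] /=; rewrite ltnNge; apply/negP => Nk.
move: ak; rewrite -lt0n truncn_gt0; apply/negP; rewrite -ltNge.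
have H : x * ln 2 / ln #|F|%:R < k%:R :> R.
  apply: (@lt_le_trans _ _ N%:R); last by rewrite ler_nat.
  apply: archi_boundP; rewrite divr_ge0 ?(ltW lq)//.
  by rewrite mulr_ge0 ?(ltW x0)// ln_ge0// ler1n.
have H2 : 2 < #|F|%:R `^ (k%:R / x) :> R.
  rewrite -ltr_ln ?posrE ?powR_gt0 ?(lt_trans _ q1)// ln_powR.
  by rewrite mulrAC ltr_pdivlMr// mulrC -ltr_pdivrMr.
rewrite ltr_pdivrMr ?mul1r; last by rewrite subr_gt0 (lt_trans _ H2)// ltr1n.
by rewrite ltrBrDr.
Qed.

(* The constant polynomial 1 is superior highly composite (it is [hhat F x] for
   every [x] below the least element of [shc_set]), but by [hhat_neq1] it is not
   attained on [shc_set]. *)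
Lemma SHC_one (F : finFieldType) (R : realType) : SHC F R 1.
Proof.
exists 3^-1; first by rewrite invr_gt0 ltr0n.
split; first exact: monic1.
have tau1 : tau (1 : {poly F}) = 1%N.
  apply/eqP; rewrite eqn_leq; apply/andP; split.
    rewrite -(card1 (NPoly (leqnn (size (1 : {poly F}))))); apply: subset_leq_card.
    apply/fintype.subsetP => d; rewrite !inE => /andP[dm d1]; apply/eqP/val_inj => /=.
    apply/eqP; rewrite -eqp_monic ?monic1// -size_poly_eq1 -dvdp1; exact: d1.
  apply/card_gt0P; exists (NPoly (leqnn (size (1 : {poly F})))).
  by rewrite inE /= monic1 dvdpp.
move=> f fm; rewrite /weighted_tau tau1 /pdeg size_poly1 /= mul0r powRr0 divr1.
have q1 : (1 < #|F|)%N by exact: card_finNzRing_gt1.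
split=> [|n0].
  rewrite leqn0 => /eqP f0.
  have -> : f = 1. 
    have /eqP/size_poly1P[c c0 fc] : size f = 1%N.
      by move: f0 (monic_neq0 fm); rewrite -size_poly_eq0; case: (size f) => [|[]].
    by move: fm; rewrite fc monicE lead_coefC => /eqP ->.
  by rewrite tau1 size_poly1 mul0r powRr0 divr1.
rewrite invrK.
rewrite -natrM powR_mulrn ?ler0n// -natrX ltr_pdivrMr ?ltr0n ?expn_gt0 ?(ltnW q1)//.
rewrite mul1r ltr_nat.
apply: (@leq_ltn_trans #|{poly_(size f) F}|); first exact: max_card.
rewrite card_npoly ltn_exp2l//.
by move: n0; case: (size f) => [|[|n]]//= _; rewrite !mulnS muln0 addn0 !(addSn, addnS) !ltnS leq_addr.
Qed.

Lemma shc_set_gt0 (F : finFieldType) (R : realType) (x : R) :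
  shc_set F R x -> 0 < x.
Proof.
move=> [s [r [s1 [r1 ->]]]].
have q1 : 1 < #|F|%:R :> R by rewrite ltr1n card_finNzRing_gt1.
by rewrite divr_gt0 ?mulr_gt0 ?ltr0n ?ln_gt0// ltrDl divr_gt0 ?ltr0n.
Qed.

Lemma hhat_neq1 (F : finFieldType) (R : realType) (x : R) :
  shc_set F R x -> hhat F x <> 1.
Proof.
move=> Sx; have x0 := shc_set_gt0 Sx; case: Sx => s [r [s1 [r1 xE]]].
have q1 : 1 < #|F|%:R :> R by rewrite ltr1n card_finNzRing_gt1.
have r0 : 0 < r%:R :> R by rewrite ltr0n.
have l0 : 0 < ln (1 + 1 / r%:R) :> R by rewrite ln_gt0// ltrDl divr_gt0.
have qs : #|F|%:R `^ (s%:R / x) = 1 + 1 / r%:R :> R.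
  apply: ln_inj.
  - by rewrite posrE powR_gt0// (lt_trans _ q1).
  - by rewrite posrE addr_gt0// divr_gt0.
  rewrite ln_powR mulrAC; apply: (canLR (mulfK (lt0r_neq0 x0))).
  by rewrite xE [RHS]mulrC divfK// lt0r_neq0.
have a1 : (0 < shc_exp F x 1)%N.
  rewrite truncn_gt0 ler_pdivlMr ?mul1r.
    rewrite lerBlDr (@le_trans _ _ (#|F|%:R `^ (s%:R / x)))//.
      by apply: ler_powR; [exact: ltW|rewrite ler_peMl ?invr_ge0 ?(ltW x0)// ler1n].
    rewrite qs lerD2l ler_pdivrMr// mul1r; by rewrite ler1n.
  rewrite subr_gt0 -ltr_ln ?posrE ?powR_gt0 ?(lt_trans _ q1)// ln1 ln_powR.
  by rewrite mulr_gt0 ?ln_gt0// ?invr_gt0.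
have XI : monic_irreducible F 1 'X.
  split; first exact: monicX.
  by split; [rewrite -['X]addr0 -polyC0; exact: irredp_XaddC | rewrite /pdeg size_polyX].
have : 'X %| hhat F x.
  rewrite /hhat -(@fsbig_widen _ _ _ _
    [set k | (1 <= k)%N /\ shc_exp F x k <> 0%N]); last 2 first.
  - by move=> k [].
  - move=> k [k1 kn] /=; apply: fsbig1 => p _.
    suff -> : shc_exp F x k = 0%N by rewrite expr0.
    by apply: contrapT => a0; apply: kn.
  rewrite (fsbigD1 1%N)/=; last 2 first.
  - exact: finite_shc_exp.
  - by split=> // a0; rewrite a0 in a1.
  apply: dvdp_mulr; rewrite (fsbigD1 'X)//=; last exact: finite_monic_irreducible.
  by apply: dvdp_mulr; rewrite -(prednK a1) exprS dvdp_mulr.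
by move=> /[swap] ->; rewrite dvdp1 size_polyX.
Qed.

(* Main.v *)
Require Import Defs.
From HB Require Import structures.
From mathcomp Require Import all_boot all_order all_algebra.
From mathcomp Require Import all_fingroup all_solvable all_field.
From mathcomp Require Import qpoly.
From mathcomp Require Import all_classical all_reals all_analysis.

(** Over the monic irreducibles [p] of degree at most some [n], both [tau f] and
    [q ^ (deg f)] factor, so [tau f / q ^ (deg f / x)] is a product of local
    weights [(e + 1) / q ^ (e k / x)], where [k = deg p] and [e] is the exponent
    of [p]. Each local weight is maximal at [e = a_k(x)], and any other maximal
    [e] is smaller; hence a maximiser divides [hhat x], and equals it as soon as
    its degree is at least that of [hhat x]. The exponent satisfies
    [r <= a_k(x)] iff [k ln q / ln (1 + 1 / r) <= x], so the jumps of [hhat] occur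
    exactly on [shc_set]; they are all visible because there are monic
    irreducibles of every positive degree. *)

Set Implicit Arguments.
Unset Strict Implicit.
Unset Printing Implicit Defensive.

Import Order.TTheory GRing.Theory Num.Theory.
Local Open Scope classical_set_scope.
Local Open Scope ring_scope.

(** * Irreducible polynomials of every degree *)

(** The extension is the splitting field of [X^(q^k) - X]: its roots are distinct and are the fixed
    points of the [k]-th power of Frobenius, so they fill the whole field, which therefore has [q^k]
    elements. *)
Lemma exists_finField_extension (F : finFieldType) (k : nat) : (0 < k)%N ->
  exists L : splittingFieldType F, \dim {:L} = k.
Proof.
move=> k_gt0; pose q := #|F|; have q_gt1 : (1 < q)%N := finNzRing_gt1 F.
have m_gt1 : (1 < q ^ k)%N by rewrite (ltn_exp2l 0).
pose Q (A : nzRingType) : {poly A} := 'X^(q ^ k) - 'X.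
have szQ (A : nzRingType) : size (Q A) = (q ^ k).+1.
  by rewrite size_polyDl size_polyXn // size_polyN size_polyX ltnS.
have nzQ (A : nzRingType) : Q A != 0 by rewrite -size_poly_eq0 szQ.
have [L [zs]] := FinSplittingFieldFor (nzQ F).
rewrite rmorphB /= map_polyXn map_polyX -/(Q L) => DQ defL.
(* The integer [q] vanishes in characteristic [p], so [Q L] has derivative [-1] and is separable. *)
have Uzs : uniq zs.
  have nq : (q ^ k)%:R = 0 :> L.
    have : #|F|%:R = 0 :> F.
      by rewrite -FinRing.zmodXgE -cardsT expg_cardG ?inE.
    rewrite natrX -/q => /(congr1 (in_alg L)).
    by rewrite rmorph_nat rmorph0 => ->; rewrite expr0n gtn_eqF.
  rewrite -separable_prod_XsubC -(eqp_separable DQ).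
  rewrite unlock /Q derivB derivX derivXn -scaler_nat -polyC1 nq scale0r sub0r.
  by rewrite -[- 1%:P]scaleN1r coprimepZr ?oppr_eq0 ?oner_eq0 ?coprimep1.
have rootQ (y : L) : root (Q L) y = (y ^+ (q ^ k) == y).
  by rewrite rootE !hornerE subr_eq0.
(* [a] is the Frobenius map [y -> y^q], the generator of the Galois group of [L] over [F]. *)
have [a _ Da] := finField_galois_generator (sub1v {:L}%AS).
have Dak y : (a ^+ k)%g y = y ^+ (q ^ k).
  elim: k {k_gt0 m_gt1 Q szQ nzQ DQ rootQ} y => [|j IH] y; first by rewrite gal_id.
  by rewrite expgSr galM ?memvf // IH Da ?memvf //= dimv1 expn1 -exprM -expnSr.
have allroot (y : L) : y ^+ (q ^ k) = y.
  (* The elements fixed by [a^k] form a subfield; it contains the roots [zs], which generate [L]. *)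
  suff : (fullv <= fixedSpace (a ^+ k)%g)%VS.
    by move/subvP/(_ y (memvf _))/fixedSpaceP; rewrite Dak.
  rewrite -defL -[X in (_ <= X)%VS]subfield_closed agenvS //.
  rewrite subv_add sub1v; apply/span_subvP => z zz.
  apply/fixedSpaceP; rewrite Dak; apply/eqP.
  by rewrite -rootQ (eqp_root DQ) root_prod_XsubC.
exists L; apply/eqP; rewrite -(eqn_exp2l _ _ q_gt1).
pose T := FinFieldExtType L.
have cardT : #|T| = (q ^ \dim {:L})%N.
  by rewrite -(@card_vspacef F T (Vector.class L)) card_vspace.
have in_zs (y : T) : y \in (zs : seq T).
  by rewrite -root_prod_XsubC -(eqp_root DQ) rootQ allroot.
(* All elements of [L] occur in the duplicate-free list [zs], whose length is the degree [q^k] of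
   [Q L]. *)
rewrite -cardT (eq_card (B := mem (zs : seq T))) => [|y]; last first.
  by rewrite [RHS]in_zs.
rewrite (@card_uniqP T zs Uzs) -eqSS -(size_prod_XsubC _ id) -(eqp_size DQ).
by rewrite szQ.
Qed.

(** The unit group of the extension of degree [k] is cyclic. A generator of it is a primitive
    element, and its minimal polynomial over [F] has degree [k]. *)
Lemma exists_monic_irreducible (F : finFieldType) (k : nat) : (0 < k)%N ->
  exists p : {poly F}, [/\ p \is monic, irreducible_poly p & size p = k.+1].
Proof.
move=> /(@exists_finField_extension F)[L dimL].
pose T := FinFieldExtType L.
have /cyclicP[u Du] := field_unit_group_cyclic [group of [set: {unit T}]].
pose z : L := val u.
have defL : <<1; z>>%VS = {:L}%VS.
  apply/vspaceP => y; rewrite memvf.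
  have [->|nz_y] := eqVneq y 0; first exact: mem0v.
  have : finField_unit (nz_y : (y : T) != 0) \in <[u]>%g.
    by rewrite -Du inE.
  case/cycleP=> i /(congr1 val); rewrite /= FinRing.val_unitX.
  by move=> ->; apply: rpredX; apply: memv_adjoin.
have /polyOver1P[p Dp] := minPolyOver 1 z.
have mp : p \is monic by have := monic_minPoly 1 z; rewrite Dp map_monic.
have sp : size p = k.+1.
  rewrite -(size_map_poly (in_alg L)) -Dp size_minPoly adjoin_degreeE.
  by rewrite [in X in (X %/ _)%N]defL dimv1 divn1 dimL.
exists p; split=> //; split=> [|r r1 rp].
  by rewrite sp ltnS -dimL adim_gt0.
have : (map_poly (in_alg L) r) %| minPoly 1 z by rewrite Dp dvdp_map.
move/minPoly_irr; rewrite alg_polyOver Dp eqp_map => /(_ isT)/orP[//|].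
by rewrite -size_poly_eq1 size_map_poly (negPf r1).
Qed.

(** * Divisor counts and factorizations *)

Section Factorization.
Variable F : finFieldType.
Implicit Types (p f g d : {poly F}) (n : nat).

Definition monic_divisors f : seq {poly F} :=
  map (fun d : {poly_(size f) F} => val d : {poly F})
    (enum [pred d : {poly_(size f) F} | (val d \is monic) && (val d %| f)]).

Lemma monic_divisors_uniq f : uniq (monic_divisors f).
Proof. by rewrite (map_inj_uniq val_inj) enum_uniq. Qed.

Lemma mem_monic_divisors f d : f != 0 ->
  (d \in monic_divisors f) = (d \is monic) && (d %| f).
Proof.
move=> f0; apply/mapP/idP => [[e] |/andP[dm df]].
  by rewrite mem_enum inE => H ->.
exists (NPoly (dvdp_leq f0 df) : {poly_(size f) F}) => //.
by rewrite mem_enum inE /= dm.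
Qed.

(** This frees divisor counting from the bounded-size type in [tau]: any duplicate-free enumeration
    of the monic divisors will do. *)
Lemma tau_uniq_size f (s : seq {poly F}) : f != 0 -> uniq s ->
  (forall d, (d \in s) = (d \is monic) && (d %| f)) -> tau f = size s.
Proof.
move=> f0 us ms; transitivity (size (monic_divisors f)).
  by rewrite /tau cardE size_map.
apply/perm_size/uniq_perm => // [|d]; first exact: monic_divisors_uniq.
by rewrite ms mem_monic_divisors.
Qed.

Lemma tau1 : tau (1 : {poly F}) = 1%N.
Proof.
rewrite (@tau_uniq_size _ [:: 1]) ?oner_neq0 // => d; rewrite inE.
apply/eqP/andP => [->|[dm d1]]; first by rewrite monic1 dvdpp.
by apply/eqP; rewrite -eqp_monic ?monic1 // -size_poly_eq1 -dvdp1.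
Qed.

Lemma dvdp_irreducible_expM p g d (a : nat) : p \is monic -> irreducible_poly p ->
  d \is monic -> d %| p ^+ a * g ->
  exists i e, [/\ (i <= a)%N, e \is monic, e %| g & d = p ^+ i * e].
Proof.
move=> pm pi; elim: a d => [|a IH] d dm.
  by rewrite expr0 mul1r => dg; exists 0%N, d; rewrite expr0 mul1r.
have [/dvdpP[c dE]|npd] := boolP (p %| d); last first.
  rewrite exprS -mulrA Gauss_dvdpr; last first.
    by rewrite coprimep_sym irreducible_poly_coprime.
  by move=> /(IH _ dm)[i [e [ia em eg dE]]]; exists i, e; split=> //; apply: leqW.
rewrite dE exprS mulrC -mulrA dvdp_mul2l ?monic_neq0 // => cd.
have cm : c \is monic by move: dm; rewrite dE monicMr.
have [i [e [ia em eg cE]]] := IH _ cm cd.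
by exists i.+1, e; split; rewrite ?ltnS // cE exprS mulrA.
Qed.

(** The map sending [(i, e)] to [p^i e] is a bijection from pairs with [i <= a] and [e] a monic
    divisor of [g] onto the monic divisors of [p^a g]. *)
Lemma tau_expM p g (a : nat) : p \is monic -> irreducible_poly p ->
  g \is monic -> ~~ (p %| g) -> tau (p ^+ a * g) = (a.+1 * tau g)%N.
Proof.
move=> pm pi gm npg; have g0 := monic_neq0 gm; have p0 := monic_neq0 pm.
pose s := monic_divisors g.
have us : uniq s := monic_divisors_uniq g.
have ms d : (d \in s) = (d \is monic) && (d %| g) := mem_monic_divisors d g0.
have pam : p ^+ a * g \is monic by rewrite monicMl // rpredX.
rewrite (tau_uniq_size g0 us ms) -[a.+1](size_iota 0).
rewrite -(size_allpairs (fun i e => p ^+ i * e)).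
apply: tau_uniq_size; first exact: monic_neq0.
- apply: allpairs_uniq => //; first exact: iota_uniq.
  move=> [i e] [j e'] /allpairsP[[i1 e1] [_ e1s [-> ->]]].
  move=> /allpairsP[[i2 e2] [_ e2s [-> ->]]] {i j e e'} /=.
  rewrite /= in e1s e2s.
  wlog le12 : i1 i2 e1 e2 e1s e2s / (i1 <= i2)%N.
    move=> H eq12; case/orP: (leq_total i1 i2) => ?; first exact: H.
    by apply/esym/H.
  rewrite -(subnKC le12) exprD -mulrA => /(mulfI (expf_neq0 _ p0)).
  (* A positive difference of exponents would make [p] divide [e1], hence [g]. *)
  case: (i2 - i1)%N => [|c] ee; first by rewrite addn0 ee expr0 mul1r.
  move: e1s; rewrite ms ee exprS -mulrA => /andP[_ pe].
  by rewrite (dvdp_trans _ pe) ?dvdp_mulIl in npg.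
move=> d; apply/allpairsP/andP => [[[i e] [+ + ->]]|[dm dg]].
  rewrite mem_iota ms add0n ltnS /= => ia /andP[em eg].
  by rewrite monicMl ?rpredX // dvdp_mul // dvdp_exp2l.
have [i [e [ia em eg dE]]] := dvdp_irreducible_expM pm pi dm dg.
by exists (i, e); rewrite mem_iota ms em eg add0n ltnS ia.
Qed.

(** An explicit list, so that factorizations become ordinary iterated products; size at most [n.+1]
    means degree at most [n]. *)
Definition irreducibles n : seq {poly F} :=
  [seq p <- [seq (val d : {poly F}) | d : {poly_n.+1 F}] |
    (p \is monic) && `[< irreducible_poly p >]].

Lemma irreducibles_uniq n : uniq (irreducibles n).
Proof. by rewrite filter_uniq // (map_inj_uniq val_inj) enum_uniq. Qed.

Lemma mem_irreducibles n p : reflect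
  [/\ p \is monic, irreducible_poly p & (pdeg p <= n)%N] (p \in irreducibles n).
Proof.
rewrite mem_filter; apply: (iffP andP) => [[/andP[pm /asboolP pi]]|[pm pi pn]].
  move=> /mapP[d _ pE]; split=> //; rewrite pE /pdeg.
  by have := size_npoly d; case: (size _).
split; first by rewrite pm; apply/asboolP.
have sp : (size p <= n.+1)%N by move: pn; rewrite /pdeg; case: (size p).
by apply/mapP; exists (NPoly sp : {poly_n.+1 F}); rewrite ?mem_enum.
Qed.

Lemma irreducibles_irr n :
  {in irreducibles n, forall p, p \is monic /\ irreducible_poly p}.
Proof. by move=> p /mem_irreducibles[]. Qed.

Lemma pdeg_irr_gt0 p : irreducible_poly p -> (0 < pdeg p)%N.
Proof. by case; rewrite /pdeg; case: (size p) => [|[]]. Qed.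

(** Strong induction on the size: a reducible [f] has a nonconstant divisor of smaller size, and an
    irreducible one only has to be made monic. *)
Lemma irreducible_divisor f : (1 < size f)%N ->
  exists2 p, p \is monic /\ irreducible_poly p & p %| f.
Proof.
elim: {f}(size f) {-2}f (leqnn (size f)) => [|n IH] f fn f1.
  by move: f1; rewrite ltnNge (leq_trans fn).
have f0 : f != 0 by rewrite -size_poly_gt0 ltnW.
have [fi|] := pselect (irreducible_poly f).
  exists ((lead_coef f)^-1 *: f); last by rewrite dvdpZl ?invr_eq0 ?lead_coef_eq0.
  split; first by rewrite monicE lead_coefZ mulVf ?lead_coef_eq0.
  have ev : (lead_coef f)^-1 *: f %= f by rewrite eqp_scale ?invr_eq0 ?lead_coef_eq0.
  split=> [|d d1]; first by rewrite (eqp_size ev).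
  by rewrite (eqp_dvdr _ ev) (eqp_rtrans ev); apply: fi.2.
move=> nfi.
have [d d1 df] : exists2 d : {poly F}, size d != 1%N & d %| f /\ ~~ (d %= f).
  apply: contrapT => H; apply: nfi; split=> // d d1 df.
  by apply: contrapT => /negP nd; apply: H; exists d.
case: df => df ndf.
have d0 : d != 0 := dvdpN0 df f0.
have sd : (size d < size f)%N.
  by rewrite ltn_neqAle dvdp_size_eqp // ndf dvdp_leq.
have [||p pP pd] := IH d; first by rewrite -ltnS (leq_trans sd).
  by rewrite ltn_neqAle eq_sym d1 size_poly_gt0.
by exists p => //; apply: dvdp_trans pd df.
Qed.

Lemma pdegM f g : f \is monic -> g \is monic -> pdeg (f * g) = (pdeg f + pdeg g)%N.
Proof.
move=> fm gm; rewrite /pdeg size_monicM ?monic_neq0 //.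
by move: (monic_neq0 fm) (monic_neq0 gm); rewrite -!size_poly_gt0;
   case: (size f) => // a; case: (size g) => // b; rewrite !addnS.
Qed.

Lemma monic_pdeg0 f : f \is monic -> pdeg f = 0%N -> f = 1.
Proof.
move=> fm f0; have /eqP/size_poly1P[c _ fc] : size f = 1%N.
  by move: f0 (monic_neq0 fm); rewrite -size_poly_eq0 /pdeg; case: (size f) => [|[]].
by move: fm; rewrite fc monicE lead_coefC => /eqP ->.
Qed.

(** Strong induction on the degree, splitting off one monic irreducible factor; its degree is at
    most [n], so it occurs in the list and its exponent goes up by one. *)
Lemma irreducible_factorization n f : f \is monic -> (pdeg f <= n)%N ->
  exists e : {poly F} -> nat, f = \prod_(p <- irreducibles n) p ^+ e p.
Proof.
elim: {f}(pdeg f) {-2}f (leqnn (pdeg f)) => [|m IH] f fm fmon fn.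
  exists (fun=> 0%N); rewrite (monic_pdeg0 fmon) ?big1 //.
  by apply/eqP; rewrite -leqn0.
have [f1|f1] := leqP (size f) 1.
  exists (fun=> 0%N); rewrite (monic_pdeg0 fmon) ?big1 //.
  by move: f1; rewrite /pdeg; case: (size f) => [|[]].
have [p [pm pi] /dvdpP[g fE]] := irreducible_divisor f1.
have gm : g \is monic by move: fmon; rewrite fE monicMr.
have p1 := pdeg_irr_gt0 pi.
have dE : pdeg f = (pdeg g + pdeg p)%N by rewrite fE pdegM.
have [|//||e gE] := IH g.
- by rewrite -ltnS (leq_trans _ fm) // dE -addn1 leq_add2l.
- by rewrite (leq_trans _ fn) // dE leq_addr.
exists (fun r => e r + (r == p))%N.
rewrite fE gE; under [RHS]eq_bigr do rewrite exprD.
rewrite big_split /=; congr (_ * _).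
rewrite (bigD1_seq p) ?irreducibles_uniq //=; last first.
  by apply/mem_irreducibles; split=> //; rewrite (leq_trans _ fn) // dE leq_addl.
by rewrite eqxx big1 ?mulr1 // => r /negPf->.
Qed.

Lemma monic_prod_exp (s : seq {poly F}) (e : {poly F} -> nat) :
  {in s, forall p, p \is monic /\ irreducible_poly p} ->
  \prod_(p <- s) p ^+ e p \is monic.
Proof.
move=> sP; rewrite big_seq; apply: rpred_prod => p /sP[pm _]; exact: rpredX.
Qed.

Lemma pdeg_prod_exp (s : seq {poly F}) (e : {poly F} -> nat) :
  {in s, forall p, p \is monic /\ irreducible_poly p} ->
  pdeg (\prod_(p <- s) p ^+ e p) = (\sum_(p <- s) e p * pdeg p)%N.
Proof.
elim: s => [|p s IH] sP; first by rewrite !big_nil /pdeg size_poly1.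
have [pm pi] := sP p (mem_head _ _).
have sP' : {in s, forall p, p \is monic /\ irreducible_poly p}.
  by move=> r rs; apply: sP; rewrite inE rs orbT.
rewrite !big_cons pdegM ?rpredX ?monic_prod_exp // IH //; congr addn.
elim: (e p) => [|i IHi]; first by rewrite /pdeg size_poly1.
by rewrite exprS pdegM ?rpredX // IHi mulSn.
Qed.

Lemma tau_prod_exp (s : seq {poly F}) (e : {poly F} -> nat) : uniq s ->
  {in s, forall p, p \is monic /\ irreducible_poly p} ->
  tau (\prod_(p <- s) p ^+ e p) = (\prod_(p <- s) (e p).+1)%N.
Proof.
elim: s => [|p s IH] /=; first by rewrite !big_nil tau1.
move=> /andP[ps us] sP; have [pm pi] := sP p (mem_head _ _).
have sP' : {in s, forall p, p \is monic /\ irreducible_poly p}.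
  by move=> r rs; apply: sP; rewrite inE rs orbT.
rewrite !big_cons tau_expM ?monic_prod_exp // ?IH //.
(* [p] is coprime to each remaining power, since distinct monic irreducibles are not associates. *)
rewrite -irreducible_poly_coprime // big_seq.
apply: (big_ind (fun f => coprimep p f)) => [|f g|r rs]; first exact: coprimep1.
  by rewrite coprimepMr => -> ->.
apply: coprimep_expr; rewrite irreducible_poly_coprime //.
have [rm ri] := sP' r rs; apply/negP => pr.
have : p %= r by apply: ri.2 => //; rewrite neq_ltn pi.1 orbT.
by rewrite eqp_monic // => /eqP pE; rewrite pE rs in ps.
Qed.

End Factorization.

(** * Maximality of the weighted divisor count *)

(** Since all factors are positive, a strict inequality at one index would make the products differ.
    This passes from equal total weights to equal local weights. *)
Lemma eq_prod_le (R : realFieldType) (T : eqType) (s : seq T) (u v : T -> R) :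
  {in s, forall i, 0 < u i <= v i} ->
  \prod_(i <- s) u i = \prod_(i <- s) v i -> {in s, u =1 v}.
Proof.
elim: s => [|i s IH] uv; first by move=> _ j.
have /andP[ui0 uvi] := uv i (mem_head _ _).
have uv' : {in s, forall i, 0 < u i <= v i}.
  by move=> j js; apply: uv; rewrite inE js orbT.
have U0 : 0 < \prod_(j <- s) u j.
  by rewrite big_seq; apply: prodr_gt0 => j /uv' /andP[].
have UV : \prod_(j <- s) u j <= \prod_(j <- s) v j.
  rewrite big_seq [leRHS]big_seq; apply: ler_prod => j /uv' /andP[u0 ->].
  by rewrite ltW.
rewrite !big_cons => E.
have uvE : u i = v i.
  apply/eqP; rewrite eq_le uvi /= leNgt; apply/negP => lt.
  have : u i * \prod_(j <- s) u j < v i * \prod_(j <- s) v j.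
    by rewrite (@lt_le_trans _ _ (v i * \prod_(j <- s) u j)) ?ltr_pM2r ?ler_pM2l //
      (lt_trans ui0).
  by rewrite E ltxx.
move: E; rewrite uvE => /(mulfI (lt0r_neq0 (lt_le_trans ui0 uvi))) E j.
by rewrite inE => /predU1P[->//|]; apply: IH.
Qed.

Lemma eq_sum_le (T : eqType) (s : seq T) (u v : T -> nat) :
  {in s, forall i, (u i <= v i)%N} ->
  (\sum_(i <- s) v i <= \sum_(i <- s) u i)%N -> {in s, u =1 v}.
Proof.
elim: s => [|i s IH] uv; first by move=> _ j.
have uvi := uv i (mem_head _ _).
have uv' : {in s, forall i, (u i <= v i)%N}.
  by move=> j js; apply: uv; rewrite inE js orbT.
have UV : (\sum_(j <- s) u j <= \sum_(j <- s) v j)%N.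
  by rewrite big_seq [leqRHS]big_seq; apply: leq_sum.
rewrite !big_cons => E.
have uvE : u i = v i.
  apply/eqP; rewrite eqn_leq uvi -(leq_add2r (\sum_(j <- s) u j)).
  by rewrite (leq_trans _ E) // leq_add2l.
move: E; rewrite uvE leq_add2l => E j.
by rewrite inE => /predU1P[->//|]; apply: IH.
Qed.

(* Passing from [r] to [r.+1] multiplies the weight by [(r + 2) / ((r + 1) Q)],
   which is at least [1] exactly when [r < a]. *)
Lemma local_weight_max (R : realFieldType) (Q : R) (a : nat) : 0 < Q ->
  (forall r, (r < a)%N = (r.+1%:R * Q <= r.+2%:R)) ->
  forall e, ((e <= a)%N -> e.+1%:R / Q ^+ e <= a.+1%:R / Q ^+ a) /\
            ((a < e)%N -> e.+1%:R / Q ^+ e < a.+1%:R / Q ^+ a).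
Proof.
move=> Q0 aP.
have step r : (r.+1%:R / Q ^+ r <= r.+2%:R / Q ^+ r.+1) = (r < a)%N.
  rewrite aP ler_pdivlMr ?exprn_gt0 // exprSr mulrA divfK //.
  by rewrite expf_neq0 ?gt_eqF.
move=> e; split=> ea.
  have H d : (e + d <= a)%N ->
      e.+1%:R / Q ^+ e <= (e + d).+1%:R / Q ^+ (e + d).
    elim: d => [|d IH]; first by rewrite addn0.
    by rewrite addnS => da; rewrite (le_trans (IH (ltnW da))) ?step.
  by have := H (a - e)%N; rewrite subnKC //; apply.
rewrite -(subnKC ea); elim: (e - a.+1)%N => [|d IH].
  by rewrite addn0 ltNge step ltnn.
by rewrite addnS (lt_trans _ IH) // ltNge step -leqNgt addSn leqW ?leq_addr.
Qed.

(** * The exponents [a_k(x)], their thresholds, and [hhat] as a finite product *)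

Section HHat.
Variables (F : finFieldType) (R : realType).
Implicit Types (x y : R) (k r n : nat).
Local Notation q := (#|F|%:R : R).

Let q_gt1 : 1 < q. Proof. by rewrite ltr1n card_finNzRing_gt1. Qed.
Let q_gt0 : 0 < q. Proof. exact: lt_trans q_gt1. Qed.

(** The solution [x] of [q^(k/x) = 1 + 1/r], which is where [a_k(x)] reaches [r]. *)
Definition threshold k r : R := k%:R * ln q / ln (1 + 1 / r%:R).

Lemma threshold_shc_set k r : (0 < k)%N -> (0 < r)%N ->
  shc_set F R (threshold k r).
Proof. by move=> k0 r0; exists k, r. Qed.

(** With [Q = q^(k/x) > 1], clearing the denominator in [r <= 1/(Q - 1)] gives [r Q <= r + 1], the
    criterion under which the local weight does not drop from [r - 1] to [r]. *)
Lemma shc_exp_geE x k r : 0 < x -> (0 < k)%N -> (0 < r)%N ->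
  (r <= shc_exp F x k)%N = (r%:R * q `^ (k%:R / x) <= r.+1%:R).
Proof.
move=> x0 k0; case: r => // r _; rewrite /shc_exp truncn_gt_nat.
have Q1 : 1 < q `^ (k%:R / x).
  rewrite -ltr_ln ?posrE ?powR_gt0 // ln1 ln_powR.
  by rewrite mulr_gt0 ?ln_gt0 ?divr_gt0 ?ltr0n.
rewrite ler_pdivlMr ?subr_gt0 // mulrBr mulr1 lerBlDr -[X in _ + X]/(r.+1%:R).
by rewrite addrC natr1.
Qed.

Lemma shc_exp_ge_threshold x k r : 0 < x -> (0 < k)%N -> (0 < r)%N ->
  (r <= shc_exp F x k)%N = (threshold k r <= x).
Proof.
move=> x0 k0 r0; rewrite shc_exp_geE //.
have r0' : 0 < r%:R :> R by rewrite ltr0n.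
have l0 : 0 < ln (1 + 1 / r%:R) :> R by rewrite ln_gt0 // ltrDl divr_gt0.
rewrite /threshold ler_pdivrMr // mulrC -ler_pdivlMr // -natr1 mulrDl mulfV ?gt_eqF //.
rewrite -ler_ln ?posrE ?powR_gt0 ?addr_gt0 ?divr_gt0 // ln_powR mulrAC.
by rewrite ler_pdivrMr // [leRHS]mulrC.
Qed.

Lemma le_shc_exp x y k : 0 < x -> x <= y -> (0 < k)%N ->
  (shc_exp F x k <= shc_exp F y k)%N.
Proof.
move=> x0 xy k0; have [->//|r0] := posnP (shc_exp F x k).
rewrite shc_exp_ge_threshold ?(lt_le_trans x0) // (le_trans _ xy) //.
by rewrite -shc_exp_ge_threshold.
Qed.

(** [threshold k 1] is linear in [k], so it exceeds [x] for large [k]. *)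
Lemma shc_exp_eventually0 x : 0 < x ->
  exists n, forall k, (n < k)%N -> shc_exp F x k = 0%N.
Proof.
move=> x0; exists (Num.bound (x / threshold 1 1)) => k nk.
have k0 : (0 < k)%N by apply: leq_ltn_trans nk.
have t0 : 0 < threshold 1 1 by apply/shc_set_gt0/threshold_shc_set.
apply/eqP; rewrite -leqn0 leqNgt shc_exp_ge_threshold //.
have -> : threshold k 1 = k%:R * threshold 1 1 by rewrite /threshold !mul1r !mulrA.
rewrite -ltNge -ltr_pdivrMr //.
apply: (@lt_trans _ _ (Num.bound (x / threshold 1 1))%:R).
  by rewrite archi_boundP // divr_ge0 // ltW.
by rewrite ltr_nat.
Qed.

Lemma eq_hhat x y : (forall k, (0 < k)%N -> shc_exp F x k = shc_exp F y k) ->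
  hhat F x = hhat F y.
Proof.
move=> xy; apply: eq_fsbigr => k; rewrite inE /= => k0.
by apply: eq_fsbigr => p _; rewrite xy.
Qed.

(** Cutting the support at [n] and grouping by degree turns the nested finitely supported products
    into one product over a list, to which the factorization lemmas apply. *)
Lemma hhat_prod x n : (forall k, (n < k)%N -> shc_exp F x k = 0%N) ->
  hhat F x = \prod_(p <- irreducibles F n) p ^+ shc_exp F x (pdeg p).
Proof.
move=> xn; rewrite /hhat -(fsbig_widen [set` iota 1 n]); last 2 first.
- by move=> k /=; rewrite mem_iota => /andP[].
- move=> k [/= k0]; rewrite mem_iota k0 add1n ltnS /= => /negP; rewrite -ltnNge.
  by move=> nk; apply: fsbig1 => p _; rewrite xn.
rewrite -fsbig_seq ?iota_uniq //.
have inner k : k \in iota 1 n ->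
    \big[*%R/1]_(p \in monic_irreducible F k) (p ^+ shc_exp F x k) =
    \prod_(p <- irreducibles F n | pdeg p == k) p ^+ shc_exp F x (pdeg p).
  rewrite mem_iota add1n ltnS => /andP[k0 kn].
  have -> : monic_irreducible F k = [set` [seq p <- irreducibles F n | pdeg p == k]].
    apply/seteqP; split=> p /=; rewrite mem_filter.
      move=> [pm [pi pk]]; rewrite pk eqxx /=; apply/mem_irreducibles.
      by rewrite pk.
    by move=> /andP[/eqP pk /mem_irreducibles[pm pi _]].
  rewrite -(fsbig_seq _ _ (filter_uniq _ (irreducibles_uniq F n))) big_filter.
  by apply: eq_bigr => p /eqP ->.
(* After exchanging the products, each [p] meets exactly one index [k], its own degree. *)
rewrite big_seq (eq_bigr _ inner) -big_seq (exchange_big_dep predT) //=.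
rewrite big_seq [RHS]big_seq; apply: eq_bigr => p /mem_irreducibles[pm pi pn].
have p0 := pdeg_irr_gt0 pi.
under eq_bigl do rewrite eq_sym.
rewrite -big_filter filter_pred1_uniq ?iota_uniq ?big_seq1 //.
by rewrite mem_iota p0 add1n ltnS.
Qed.

(** * Maximality and uniqueness of [hhat] *)

Lemma powR_div_nat x k : q `^ (k%:R / x) = (q `^ x^-1) ^+ k.
Proof. by rewrite mulrC powRrM powR_mulrn // powR_ge0. Qed.

Lemma weighted_tau_prod x n (e : {poly F} -> nat) :
  weighted_tau x (\prod_(p <- irreducibles F n) p ^+ e p) =
  \prod_(p <- irreducibles F n) ((e p).+1%:R / q `^ ((pdeg p)%:R / x) ^+ e p).
Proof.
rewrite /weighted_tau tau_prod_exp ?irreducibles_uniq //; last exact: irreducibles_irr.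
rewrite pdeg_prod_exp; last exact: irreducibles_irr.
rewrite powR_div_nat natr_prod big_split /= prodfV expr_sum; congr (_ / _).
by apply: eq_bigr => p _; rewrite powR_div_nat mulnC exprM.
Qed.

(** The degree is the sum of the [e p * pdeg p] with every [pdeg p] positive, so lowering any
    exponent would lower it strictly. *)
Lemma pdeg_prod_exp_eq n (e e' : {poly F} -> nat) :
  {in irreducibles F n, forall p, (e p <= e' p)%N} ->
  (pdeg (\prod_(p <- irreducibles F n) p ^+ e' p)
    <= pdeg (\prod_(p <- irreducibles F n) p ^+ e p))%N ->
  {in irreducibles F n, e =1 e'}.
Proof.
move=> ee'; rewrite !pdeg_prod_exp; [|exact: irreducibles_irr..].
move=> /eq_sum_le E p ps.
have /irreducibles_irr[_ /pdeg_irr_gt0 p0] := ps.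
apply/eqP; rewrite -(eqn_pmul2r p0) E // => r rs.
by rewrite leq_mul2r ee' ?orbT.
Qed.

Lemma monic_hhat x : 0 < x -> hhat F x \is monic.
Proof.
move=> /shc_exp_eventually0[n /hhat_prod->]; apply: monic_prod_exp.
exact: irreducibles_irr.
Qed.

Lemma weighted_tau_hhat_max x (f : {poly F}) : 0 < x -> f \is monic ->
  weighted_tau x f <= weighted_tau x (hhat F x) /\
  (weighted_tau x f = weighted_tau x (hhat F x) ->
   (pdeg (hhat F x) <= pdeg f)%N -> f = hhat F x).
Proof.
move=> x0 fm; have [n0 n0P] := shc_exp_eventually0 x0.
(* This bound lets [f] and [hhat F x] be written as products over the same list. *)
pose n := maxn n0 (pdeg f).
rewrite (@hhat_prod x n) => [|k nk]; last first.
  by rewrite n0P // (leq_ltn_trans _ nk) // leq_maxl.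
have [|e ->] := @irreducible_factorization F n f fm; first exact: leq_maxr.
pose a (p : {poly F}) := shc_exp F x (pdeg p).
pose w (p : {poly F}) m := m.+1%:R / q `^ ((pdeg p)%:R / x) ^+ m.
have loc p : p \in irreducibles F n ->
    ((e p <= a p)%N -> w p (e p) <= w p (a p)) /\
    ((a p < e p)%N -> w p (e p) < w p (a p)).
  move=> /irreducibles_irr[_ /pdeg_irr_gt0 p0].
  apply: local_weight_max => [|r]; first exact: powR_gt0.
  exact: shc_exp_geE.
have le p : p \in irreducibles F n -> 0 < w p (e p) <= w p (a p).
  move=> ps; rewrite divr_gt0 ?ltr0n ?exprn_gt0 ?powR_gt0 //=.
  by have [le lt] := loc p ps; have [/le//|/lt/ltW//] := leqP (e p) (a p).
split.
  rewrite !weighted_tau_prod big_seq [leRHS]big_seq.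
  by apply: ler_prod => p /le /andP[/ltW -> ->].
rewrite !weighted_tau_prod => /(eq_prod_le le) eqw dg.
rewrite big_seq [RHS]big_seq; apply: eq_bigr => p ps; congr (_ ^+ _).
apply: (@pdeg_prod_exp_eq n _ a) => // r rs.
(* An exponent above [a r] would have strictly smaller local weight, against [eqw]; so [e <= a]
   throughout, and the degree hypothesis forces equality. *)
by rewrite leqNgt; apply/negP => /(loc r rs).2; rewrite [w r _]eqw // ltxx.
Qed.

Lemma x_SHC_hhat x : 0 < x -> x_SHC x (hhat F x).
Proof.
move=> x0; split=> [|f fm]; first exact: monic_hhat.
have [le eq] := weighted_tau_hhat_max x0 fm; split=> // hf.
rewrite lt_neqAle le andbT; apply/eqP => /eq /(_ (ltnW hf)) fE.
by rewrite fE ltnn in hf.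
Qed.

(** If [h] had smaller degree than [hhat F x], its weight would have to be strictly larger, against
    maximality. Otherwise the two weights agree and the equality case applies. *)
Lemma x_SHC_unique x (h : {poly F}) : 0 < x -> x_SHC x h -> h = hhat F x.
Proof.
move=> x0 [hm hP]; have [le eq] := weighted_tau_hhat_max x0 hm.
have [hle hlt] := hP _ (monic_hhat x0).
have [dg|/hlt] := leqP (pdeg (hhat F x)) (pdeg h); last by rewrite ltNge le.
by apply: eq => //; apply/eqP; rewrite eq_le le hle.
Qed.

Lemma highly_composite_hhat x : 0 < x -> highly_composite (hhat F x).
Proof.
move=> x0; split=> [|g gm dg]; first exact: monic_hhat.
have [+ _] := weighted_tau_hhat_max x0 gm.
rewrite /weighted_tau ler_pdivrMr ?powR_gt0 // mulrAC -mulrA => le.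
(* [tau g] is at most [tau (hhat F x)] times a ratio of powers of [q], and that ratio is at most 1
   because [pdeg g <= pdeg (hhat F x)]. *)
rewrite -(ler_nat R) (le_trans le) // ler_piMr // ler_pdivrMr ?powR_gt0 // mul1r.
by rewrite ler_powR ?(ltW q_gt1) // ler_pM2r ?invr_gt0 // ler_nat.
Qed.

(** At equal degrees weights compare as divisor counts, so [g] also attains the maximal weight. *)
Lemma highly_composite_hhat_unique x (g : {poly F}) : 0 < x ->
  highly_composite g -> pdeg g = pdeg (hhat F x) -> g = hhat F x.
Proof.
move=> x0 [gm gP] dg; have [le eq] := weighted_tau_hhat_max x0 gm.
apply: eq; last by rewrite dg.
apply/eqP; rewrite eq_le le /weighted_tau dg ler_pM2r ?invr_gt0 ?powR_gt0 //.
by rewrite ler_nat gP ?dg // monic_hhat.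
Qed.

(** * The jumps of [hhat] and the correspondence with [S] *)

Lemma hhat_consecutive x' x'' x : consecutive (shc_set F R) x' x'' ->
  x' <= x -> x < x'' -> hhat F x = hhat F x'.
Proof.
move=> [/shc_set_gt0 x'0 _ _ gap] x'x xx''.
have x0 : 0 < x := lt_le_trans x'0 x'x.
apply: eq_hhat => k k0; apply/eqP; rewrite eqn_leq (le_shc_exp x'0 x'x k0) andbT.
rewrite leqNgt; apply/negP => lt.
have r0 : (0 < shc_exp F x k)%N by apply: leq_ltn_trans lt.
(* If [a_k] grew between [x'] and [x], the threshold for its value at [x] would be an element of [S]
   strictly between [x'] and [x'']. *)
have /negP := gap _ (threshold_shc_set k0 r0); apply.
rewrite (le_lt_trans _ xx'') -?shc_exp_ge_threshold //.
by rewrite andbT ltNge -shc_exp_ge_threshold // -ltnNge.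
Qed.

(** Take for [y] the largest threshold of a positive exponent [a_k(x)]. Then [y <= x] gives
    [a_k(y) <= a_k(x)], and [y] being above every such threshold gives the converse. *)
Lemma hhat_shc_set_surj x : 0 < x -> hhat F x != 1 ->
  exists2 y, shc_set F R y & hhat F y = hhat F x.
Proof.
move=> x0 h1; have [n nP] := shc_exp_eventually0 x0.
pose P (i : 'I_n.+1) := (0 < i)%N && (0 < shc_exp F x i)%N.
have [i0 Pi0] : exists i, P i.
  apply/existsP; apply: contraNT h1 => /existsPn nex.
  apply/eqP; apply: fsbig1 => k /= k0; apply: fsbig1 => p _.
  suff -> : shc_exp F x k = 0%N by rewrite expr0.
  have [kn|/nP//] := leqP k n.
  apply/eqP; rewrite -leqn0 leqNgt; apply/negP => e0.
  by have := nex (Ordinal (kn : (k < n.+1)%N)); rewrite /P /= k0 e0.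
pose t (i : 'I_n.+1) := threshold i (shc_exp F x i).
have [i /andP[i_gt0 ri_gt0] imax] := arg_maxP t Pi0.
have Sy := threshold_shc_set i_gt0 ri_gt0.
have y0 := shc_set_gt0 Sy.
exists (t i) => //; apply: eq_hhat => k k0; apply/eqP; rewrite eqn_leq.
rewrite le_shc_exp -?shc_exp_ge_threshold //=.
have [->//|rk0] := posnP (shc_exp F x k).
have kn : (k < n.+1)%N.
  by rewrite ltnS leqNgt; apply/negP => /nP rk; rewrite rk in rk0.
rewrite shc_exp_ge_threshold //.
by have := imax (Ordinal kn); rewrite /P /= k0 rk0; apply.
Qed.

(** For [x < y = threshold k r], the exponent [a_k] is below [r] at [x] and at least [r] at [y]; an
    irreducible polynomial of degree [k] makes the difference visible in [hhat]. *)
Lemma hhat_inj : set_inj (shc_set F R) (fun x : R => hhat F x).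
Proof.
move=> x y; rewrite !inE => Sx Sy.
wlog xy : x y Sx Sy / x < y.
  move=> H E; have [xy|yx|//] := ltgtP x y; first exact: H.
  by apply/esym/H.
have x0 := shc_set_gt0 Sx; have y0 := shc_set_gt0 Sy.
case: Sy => k [r [k0 [r0 yE]]].
have [nx nxP] := shc_exp_eventually0 x0; have [ny nyP] := shc_exp_eventually0 y0.
pose n := maxn k (maxn nx ny).
rewrite (@hhat_prod x n) => [|j]; last by rewrite !gtn_max => /and3P[_ /nxP].
rewrite (@hhat_prod y n) => [|j]; last by rewrite !gtn_max => /and3P[_ _ /nyP].
move=> hE; have [p [pm pi sp]] := exists_monic_irreducible F k0.
have pk : pdeg p = k by rewrite /pdeg sp.
have ps : p \in irreducibles F n.
  by apply/mem_irreducibles; split=> //; rewrite pk leq_maxl.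
(* The exponents at [x] are at most those at [y], so equal degrees of the two products force them to
   agree, in particular at [p]. *)
have := @pdeg_prod_exp_eq n (fun p => shc_exp F x (pdeg p))
  (fun p => shc_exp F y (pdeg p)).
rewrite hE leqnn => /(_ _ isT p ps) /=; rewrite pk => E.
have : (r <= shc_exp F y k)%N by rewrite shc_exp_ge_threshold // yE.
rewrite -E => [|s ss]; last first.
  by apply: le_shc_exp; rewrite ?ltW //; have /irreducibles_irr[_ /pdeg_irr_gt0] := ss.
by rewrite shc_exp_ge_threshold // /threshold -yE leNgt xy.
Qed.

End HHat.

Theorem theorem1p1 (F : finFieldType) (R : realType) :
  (forall x : R, 0 < x ->
    [/\ x_SHC x (hhat F x),
        (forall h : {poly F}, x_SHC x h -> h = hhat F x),
        highly_composite (hhat F x)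
      & (forall g : {poly F}, highly_composite g ->
           pdeg g = pdeg (hhat F x) -> g = hhat F x)])
  /\
  (forall x' x'' : R, consecutive (shc_set F R) x' x'' ->
     forall x : R, x' <= x -> x < x'' -> hhat F x = hhat F x')
  /\
  set_bij (shc_set F R) (SHC F R `\ (1 : {poly F})) (fun x : R => hhat F x).
Proof.
split.
  move=> x x0; split.
  - exact: x_SHC_hhat.
  - by move=> h; apply: x_SHC_unique.
  - exact: highly_composite_hhat.
  - by move=> g; apply: highly_composite_hhat_unique.
split; first by move=> x' x'' ? x; apply: hhat_consecutive.
split; last 2 first.
- exact: hhat_inj.
(* By uniqueness [h] is [hhat F x] for some positive [x], possibly outside [S]; as [h] is not 1, it
   is also attained at a point of [S]. *)
- move=> h [[x x0 /(x_SHC_unique x0) ->] /eqP h1].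
  by have [y Sy <-] := hhat_shc_set_surj x0 h1; exists y.
move=> x Sx; split; last exact: hhat_neq1.
by exists x; [exact: shc_set_gt0 Sx | exact/x_SHC_hhat/shc_set_gt0/Sx].
Qed.
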